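(* Let $S$ be any subset of the set $\mathcal{P}$ of all partitions, and let $F_S(t,q)$, $o_S(n)$, $e_S(n)$ be as defined in the context. Then, as formal power series in $q$, $$F_S(i,-iq)=\sum_{n\ge 0}(-1)^{\lceil n/2\rceil}\bigl(o_S(n)-e_S(n)\bigr)q^n,$$ where $i=\sqrt{-1}$.
   Context: A partition of $n$ is a weakly decreasing finite sequence of positive integers with sum $n$; the empty sequence is the only partition of $0$. $\mathcal{P}$ is the set of all partitions. For $S\subseteq\mathcal{P}$, $S_n$ is the set of $\lambda\in S$ that are partitions of $n$. $\mathrm{op}(\lambda)$ is the number of odd parts of $\lambda$ (with multiplicity). Meander: given two compositions (or partitions) $\lambda=(\lambda_1,\dots,\lambda_r)$ and $\mu=(\mu_1,\dots,\mu_s)$ of $n$, the meander of type $\frac{\lambda}{\mu}$ is the graph on $n$ vertices placed in a row, with the following edges. Split the row into consecutive blocks of sizes $\lambda_1,\dots,\lambda_r$, and name the vertices of the $i$-th block, in order, $v_{i,1},\dots,v_{i,\lambda_i}$; for each $i$ and each $1\le j\le\lfloor\lambda_i/2\rfloor$ add a ''top'' edge joining $v_{i,j}$ and $v_{i,\lambda_i+1-j}$. Do the same with $\mu$ in place of $\lambda$ to get ''bottom'' edges. If a top edge and a bottom edge join the same two vertices, both are kept and they form a cycle (of length 2). Every connected component is a cycle or a path, an isolated vertex being counted as a path. Define $\mathrm{ind}_\mu(\lambda)=2C+P-1$, where $C$ and $P$ are the numbers of cycles and paths of the meander. Index of a partition: for $\lambda$ a partition of $n\ge1$, $\mathrm{ind}(\lambda):=\mathrm{ind}_\mu(\lambda)$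 where $\mu=(n)$ is the one-part partition. For the empty partition, $\mathrm{ind}(\emptyset):=-1$. Counting functions: $e_S(n):=\#\{\lambda\in S_n: \mathrm{ind}(\lambda)\text{ is even}\}$, $o_S(n):=\#\{\lambda\in S_n: \mathrm{ind}(\lambda)\text{ is odd}\}$, $f_S(k,n):=\#\{\lambda\in S_n:\mathrm{op}(\lambda)=k\}$, and $F_S(t,q):=\sum_{k,n\ge0}f_S(k,n)t^kq^n$ (for each $n$ only finitely many $k$ contribute). *)

(* Defs.v *)
From HB Require Import structures.
From mathcomp Require Import all_boot all_order all_algebra finmap.
From mathcomp Require Import boolp classical_sets functions cardinality fsbigop.
Set Implicit Arguments.
Unset Strict Implicit.
Unset Printing Implicit Defensive.
Import GRing.Theory Num.Theory.

Record intpart := IntPart {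
  parts :> seq nat;
  _ : sorted geq parts && all (ltn 0) parts }.

HB.instance Definition _ := [isSub for parts].
HB.instance Definition _ := [Choice of intpart by <:].

(* A loopless multigraph on a finite type [V] is given by the list (up to
   permutation) of the endpoint sets of its edges, one entry per edge. *)
Definition adj (V : finType) (E : seq {set V}) : rel V :=
  [rel x y | [set x; y]%SET \in E].

Definition components (V : finType) (E : seq {set V}) : {set {set V}} :=
  [set [set y | connect (adj E) x y]%SET | x in V]%SET.

Definition edges_in (V : finType) (E : seq {set V}) (K : {set V}) :
    seq {set V} :=
  [seq e : {set V} <- E | e \subset K].

Definition path_edges (V : finType) (s : seq V) : seq {set V} :=
  [seq [set p.1; p.2]%SET | p <- zip s (behead s)].

(* For [s = [:: x; y]] this lists [[set x; y]] twice: a cycle of length 2. *)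
Definition cycle_edges (V : finType) (s : seq V) : seq {set V} :=
  [seq [set p.1; p.2]%SET | p <- zip s (rot 1 s)].

Definition is_path (V : finType) (E : seq {set V}) (K : {set V}) : bool :=
  [exists s : #|K|.-tuple V,
    [&& uniq s, [set x in s]%SET == K
      & perm_eq (edges_in E K) (path_edges s)]].

Definition is_cycle (V : finType) (E : seq {set V}) (K : {set V}) : bool :=
  [&& 1 < #|K| & [exists s : #|K|.-tuple V,
    [&& uniq s, [set x in s]%SET == K
      & perm_eq (edges_in E K) (cycle_edges s)]]].

Definition npaths (V : finType) (E : seq {set V}) : nat :=
  #|[set K in components E | is_path E K]%SET|.
Definition ncycles (V : finType) (E : seq {set V}) : nat :=
  #|[set K in components E | is_cycle E K]%SET|.

(* Position in the row, counted from 0, of the j-th vertex (j >= 1) of the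
   block of index i (i >= 0) of the composition [c]. *)
Definition vpos (c : seq nat) (i j : nat) : nat := (sumn (take i c) + j).-1.

Definition arcs (n : nat) (c : seq nat) : seq {set 'I_n} :=
  [seq [set x : 'I_n | (val x == vpos c i j)
                    || (val x == vpos c i ((nth 0 c i).+1 - j))]%SET
     | i <- iota 0 (size c), j <- iota 1 (nth 0 c i)./2].

(* Meaningful when [sumn lam = sumn mu = n]; top edges, then bottom edges. *)
Definition meander (n : nat) (lam mu : seq nat) : seq {set 'I_n} :=
  arcs n lam ++ arcs n mu.

Definition ind_wrt (mu lam : seq nat) : int :=
  let G := meander (sumn lam) lam mu in
  (2 * (ncycles G)%:Z + (npaths G)%:Z - 1)%R.

Definition ind (lam : intpart) : int :=
  if nilp lam then (-1)%R else ind_wrt [:: sumn lam] lam.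

Definition op (lam : intpart) : nat := count odd lam.

Local Open Scope classical_set_scope.
Local Open Scope fset_scope.

Definition graded (S : set intpart) (n : nat) : set intpart :=
  [set lam | S lam /\ sumn lam = n].

(* [fset_set] is only meaningful on finite sets; cf. [finite_graded]. *)
Definition e_ (S : set intpart) (n : nat) : nat :=
  #|` fset_set [set lam | graded S n lam /\ (2 %| ind lam)%Z] |.

Definition o_ (S : set intpart) (n : nat) : nat :=
  #|` fset_set [set lam | graded S n lam /\ ~~ (2 %| ind lam)%Z] |.

Definition f_ (S : set intpart) (k n : nat) : nat :=
  #|` fset_set [set lam | graded S n lam /\ op lam = k] |.

Lemma finite_graded (S : set intpart) (n : nat) : finite_set (graded S n).
Proof.
pose nil0 : intpart := @IntPart [::] isT.
pose h (b : n.-bseq 'I_n.+1) : intpart := insubd nil0 (map val b).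
apply: (@sub_finite_set _ _ (h @` [set: n.-bseq 'I_n.+1])); last first.
  by apply: finite_image; exact: finite_finset.
move=> lam [_ lamn].
have leS (s : seq nat) : all (ltn 0) s ->
    (size s <= sumn s) && all (fun x => x <= sumn s) s.
  elim: s => //= x s IHs /andP[x0 /IHs/andP[szs als]].
  rewrite leq_addr -add1n leq_add //=; apply: sub_all als => y ys.
  exact: leq_trans ys (leq_addl _ _).
have /andP[_ /leS/andP[]] := valP lam; rewrite /= lamn => szl all_l.
exists (insub_bseq n (map inord lam)) => //; apply: val_inj.
have mapE : [seq val x | x <- [seq (inord x : 'I_n.+1) | x <- lam]] = lam.
  rewrite -map_comp map_id_in // => x xlam /=.
  by rewrite inordK // ltnS; move/allP: all_l; apply.
have bE : (insub_bseq n (map (inord : nat -> 'I_n.+1) lam) : seq 'I_n.+1) =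
    map inord lam.
  by rewrite /insub_bseq; apply: insubdK; rewrite unfold_in size_map.
by rewrite /h bE val_insubd mapE; have /= -> := valP lam.
Qed.

Local Open Scope ring_scope.

(* A formal power series in q over a ring A is the sequence [nat -> A] of its
   coefficients. [F_ R S] is F_S(t,q) seen in R[t][[q]], with t written 'X; the
   sum over k has finite support, cf. [coef_F]. *)
Definition F_ (R : nzRingType) (S : set intpart) : nat -> {poly R} :=
  fun n => \sum_(k \in [set: nat]) ((f_ S k n)%:R *: 'X^k : {poly R}).

Lemma f_gt (S : set intpart) (k n : nat) : (n < k)%N -> f_ S k n = 0%N.
Proof.
move=> nk; rewrite /f_.
suff -> : [set lam | graded S n lam /\ op lam = k] = set0 by rewrite fset_set0.
rewrite -subset0 => lam [[_ lamn] opk] /=.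
suff: (op lam <= sumn lam)%N by rewrite opk lamn leqNgt nk.
rewrite /op; elim: (parts lam) => //= x s IHs.
by apply: leq_add => //; case: x => // x; exact: leq_trans (leq_b1 _) _.
Qed.

Lemma coef_F (R : nzRingType) (S : set intpart) (n k : nat) :
  (F_ R S n)`_k = (f_ S k n)%:R.
Proof.
rewrite /F_ (fsbigE (iota 0 n.+1)) ?iota_uniq //; last first.
  move=> j _ jn; rewrite f_gt ?scale0r // ltnNge; apply/negP => jn'.
  by move/negP: jn; apply; rewrite mem_iota.
rewrite (eq_bigl xpredT) => [|j]; last by rewrite in_setT.
rewrite coef_sum; under eq_bigr do rewrite coefZ coefXn.
have [kn|nk] := ltnP k n.+1.
  rewrite (bigD1_seq k) ?iota_uniq ?mem_iota //= eqxx mulr1 big1 ?addr0 //.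
  by move=> j jk; rewrite eq_sym (negPf jk) mulr0.
rewrite f_gt // big_seq big1 // => j; rewrite mem_iota add0n => /andP[_ jn].
by rewrite eq_sym (ltn_eqF (leq_trans jn nk)) mulr0.
Qed.

(* The series G(a, c q) in R[[q]], for G(t,q) in R[t][[q]]. *)
Definition subst_tq (R : nzRingType) (G : nat -> {poly R}) (a c : R) :
    nat -> R :=
  fun n => (G n).[a] * c ^+ n.

(* Main.v *)
(* Superposing two matchings, a meander has maximal degree 2. Each component K
   of such a graph has a Hamiltonian path, so it carries at least |K| - 1 edges,
   and at most |K| by counting degrees; it is a path exactly in the first case.
   Hence the number of paths is the number of vertices minus the number of
   edges. For the meander of a partition lam of n against (n), this is the
   ceiling of op(lam)/2, so ind(lam) is even iff that ceiling is odd, and the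
   identity follows by comparing coefficients of q^n, using that op(lam) and n
   have the same parity. *)
Require Import Defs.
From mathcomp Require Import all_boot all_order all_algebra.
From mathcomp Require Import classical_sets.
From mathcomp Require Import finmap boolp cardinality zify ring.
Set Implicit Arguments.
Unset Strict Implicit.
Unset Printing Implicit Defensive.
Import GRing.Theory Num.Theory.
Local Open Scope ring_scope.

(** * Graphs of maximal degree two: counting the path components *)

Section MaxDegreeTwo.
Local Open Scope nat_scope.
Variables (V : finType) (E : seq {set V}).
Hypothesis card_edge : forall e, e \in E -> #|e| = 2.
Hypothesis max_degree2 : forall v, count (fun e : {set V} => v \in e) E <= 2.

Definition component (x : V) := [set y | connect (adj E) x y]%SET.

Lemma adj_sym : symmetric (adj E).
Proof. by move=> x y; rewrite /adj /= finset.setUC. Qed.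

Let csym : connect_sym (adj E).
Proof. exact: sym_connect_sym adj_sym. Qed.

Lemma mem_components x : component x \in components E.
Proof. by apply/imsetP; exists x. Qed.

Lemma mem_component (K : {set V}) x :
  K \in components E -> (x \in K) = (K == component x).
Proof.
case/imsetP=> z _ ->; rewrite inE; apply/idP/eqP => [zx|/setP/(_ x)].
  by apply/setP=> y; rewrite !inE (same_connect csym zx).
by rewrite !inE connect0.
Qed.

(** The components partition the vertices. The form as a sum lets counts over components become
    counts of vertices, or of edges, by exchanging sums. *)
Lemma sum_mem_component x : \sum_(K in components E) (x \in K) = 1.
Proof.
rewrite (bigD1 (component x)) ?mem_components //=.
rewrite (mem_component _ (mem_components x)) eqxx big1 // => K /andP[KE Kx].
by rewrite mem_component // (negPf Kx).
Qed.

Lemma sum_card_component : \sum_(K in components E) #|K| = #|V|.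
Proof.
under eq_bigr do rewrite -sum1_card big_mkcond /=.
rewrite exchange_big /= -sum1_card; apply: eq_bigr => x _.
rewrite -[RHS](sum_mem_component x).
by apply: eq_bigr => K _; case: (x \in K).
Qed.

(** The two endpoints of an edge are adjacent, hence connected, so one endpoint decides in which
    component the whole edge lies. *)
Lemma edge_sub_component (K : {set V}) e x :
  K \in components E -> e \in E -> x \in e -> (e \subset K) = (x \in K).
Proof.
move=> KE eE xe; apply/fintype.subsetP/idP => [/(_ x xe) //|xK y ye].
have [<- //|xy] := eqVneq x y.
have eq_e : [set x; y]%SET = e.
  apply/eqP; rewrite eqEcard finset.subUset !finset.sub1set xe ye cards2 xy /=.
  by rewrite card_edge.
move: xK; rewrite mem_component // => /eqP ->; rewrite inE.
by apply: connect1; rewrite /adj /= eq_e.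
Qed.

Lemma sum_size_edges_in : \sum_(K in components E) size (edges_in E K) = size E.
Proof.
under eq_bigr do rewrite size_filter -sum1_count big_mkcond big_seq /=.
rewrite exchange_big /= -sum1_size [RHS]big_seq; apply: eq_bigr => e eE.
have /card_gt0P[x xe] : 0 < #|e| by rewrite card_edge.
rewrite -[RHS](sum_mem_component x); apply: eq_bigr => K KE.
by rewrite (edge_sub_component KE eE xe); case: (x \in K).
Qed.

(* Double counting of incidences inside [K]. *)
Lemma size_edges_in_le (K : {set V}) : size (edges_in E K) <= #|K|.
Proof.
rewrite -(leq_pmul2r (ltn0Sn 1)).
have -> : size (edges_in E K) * 2 =
    \sum_(v in K) count (fun e : {set V} => v \in e) (edges_in E K).
  under eq_bigr do rewrite -sum1_count big_mkcond /=.
  rewrite exchange_big /= -sum1_size big_distrl /= !big_seq.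
  apply: eq_bigr => e; rewrite mem_filter => /andP[eK eE].
  rewrite mul1n -(card_edge eE) -sum1_card -big_mkcondr /=.
  apply: eq_bigl => x; apply/idP/andP => [xe|[]//].
  by rewrite xe (fintype.subsetP eK).
rewrite -sum_nat_const; apply: leq_sum => v _.
apply: leq_trans (max_degree2 v).
by rewrite /edges_in count_filter; apply: sub_count => e /= /andP[].
Qed.

Lemma size_path_edges (s : seq V) : size (path_edges s) = (size s).-1.
Proof. by rewrite size_map size_zip size_behead; lia. Qed.

Lemma path_edges_subset (s : seq V) e x :
  e \in path_edges s -> x \in e -> x \in s.
Proof.
elim: s => [//|a [//|b s] IHs].
rewrite /path_edges /= -/(path_edges (b :: s)) inE => /orP[/eqP ->|eb xe].
  by rewrite !inE => /orP[] ->; rewrite ?orbT.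
by rewrite inE IHs ?orbT.
Qed.

(** The first edge contains the first vertex, which no later edge meets. This is what allows
    comparing lengths with the edge list [E], where an edge may occur twice. *)
Lemma path_edges_uniq (s : seq V) : uniq s -> uniq (path_edges s).
Proof.
elim: s => [//|x [//|y s] IHs] /andP[xs us].
rewrite /path_edges /= -/(path_edges (y :: s)) IHs // andbT.
apply: contra xs => xy; apply: (path_edges_subset xy).
by rewrite !inE eqxx.
Qed.

Lemma path_edges_sub (s : seq V) :
  sorted (adj E) s -> {subset path_edges s <= E}.
Proof.
elim: s => [//|x [//|y s] IHs] /andP[xy ys] e.
rewrite /path_edges /= -/(path_edges (y :: s)) inE => /orP[/eqP -> //|].
exact: IHs.
Qed.

(** Distinct neighbours of [v] other than [v] itself give distinct edges at [v]. *)
Lemma degree_le2 v (s : seq V) :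
  uniq s -> v \notin s -> all (adj E v) s -> size s <= 2.
Proof.
move=> us vs /allP adjs.
pose t := [seq [set v; x]%SET | x <- s].
have ut : uniq t.
  rewrite map_inj_in_uniq // => x y xs ys /setP/(_ x).
  rewrite !inE eqxx orbT => /esym/orP[/eqP xv|/eqP //].
  by rewrite -xv xs in vs.
apply: leq_trans (max_degree2 v).
rewrite -size_filter -(size_map (fun x => [set v; x]%SET)).
apply: uniq_leq_size => // e /mapP[x xs ->].
rewrite mem_filter !inE eqxx /=; exact: adjs.
Qed.

(* A longest simple path is closed under adjacency: its inner vertices have
   already used up their degree, its ends cannot be extended. *)
Lemma hamiltonian_component (K : {set V}) : K \in components E ->
  exists s : seq V, [/\ uniq s, sorted (adj E) s & [set x in s]%SET = K].
Proof.
move=> KE; have /imsetP[z _ defK] := KE.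
pose P m := [exists t : m.-tuple V,
  [&& uniq t, sorted (adj E) t & all (mem K) t]].
have exP : exists m, P m.
  by exists 1; apply/existsP; exists [tuple z]; rewrite /= defK inE connect0.
have P_le m : P m -> m <= #|V|.
  case/existsP=> t /and3P[ut _ _].
  by rewrite -(size_tuple t) -(card_uniqP ut) max_card.
case: (ex_maxnP exP P_le) => m Pm max_m.
have m_gt0 : 0 < m.
  apply: max_m; apply/existsP; exists [tuple z].
  by rewrite /= defK inE connect0.
case/existsP: Pm => t; case/and3P; move: (size_tuple t).
move: (tval t) => s sz us sorts sK.
have max_s (s' : seq V) : uniq s' -> sorted (adj E) s' -> all (mem K) s' ->
    size s' <= size s.
  move=> us' sorts' sK'; rewrite sz; apply: max_m; apply/existsP.
  by exists (in_tuple s'); rewrite us' sorts' sK'.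
exists s; split=> //; apply/eqP; rewrite finset.eqEsubset; apply/andP; split.
  by apply/fintype.subsetP => x; rewrite inE => /(allP sK).
have closed_s : closed (adj E) (mem s).
  apply: (intro_closed csym) => v x vx vs; apply/negPn/negP => xs.
  have vK : v \in K := allP sK v vs.
  have xK : x \in K.
    move: vK; rewrite mem_component // => /eqP ->.
    by rewrite inE connect1.
  (* Split the path at [v], which has a neighbour [x] off the path. If [v] comes first, [x] can be
     prepended; if last, appended; otherwise [v] has the three neighbours [u], [w] and [x]. *)
  case/splitPr: s / vs sz us sorts sK max_s xs => p1 p2 _ us sorts sK max_s xs.
  have xv : adj E x v by rewrite adj_sym.
  case/lastP: p1 us sorts sK max_s xs => [|p1 u] us sorts sK max_s xs.
    have := max_s [:: x, v & p2]; rewrite /= ltnn => absurd.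
    apply: notF; apply: absurd; last by rewrite /= in sK *; rewrite xK.
      by move: us xs => /= -> ->.
    by rewrite xv.
  case: p2 us sorts sK max_s xs => [|w p2] us sorts sK max_s xs.
    have := max_s (rcons (rcons p1 u ++ [:: v]) x).
    rewrite size_rcons ltnn => absurd; apply: notF; apply: absurd.
    - by rewrite rcons_uniq xs us.
    - case: (p1) sorts => [|y p] /=; first by rewrite vx !andbT.
      by rewrite !cats1 => sorts; rewrite rcons_path sorts last_rcons.
    - by rewrite all_rcons sK andbT.
  have adj_vu : adj E v u.
    rewrite adj_sym; move: sorts; rewrite cat_rcons; case: (p1) => [|y p] /=.
      by case/andP.
    by rewrite cat_path /= => /and4P[].
  have adj_vw : adj E v w.
    move: sorts; case: (p1) => [|y p] /=; first by case/and3P.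
    by rewrite cat_path /= => /and4P[].
  have : uniq [:: u; v; w; x].
    have: subseq [:: u; v; w] (rcons p1 u ++ [:: v, w & p2]).
      rewrite cat_rcons; apply: subseq_trans (suffix_subseq _ _).
      by rewrite /= !eqxx sub0seq.
    move=> sub; rewrite -[[:: u; v; w; x]]/(rcons [:: u; v; w] x) rcons_uniq.
    rewrite (subseq_uniq sub us) andbT.
    by apply: contra xs; apply: (mem_subseq sub).
  rewrite /= !inE !negb_or => /and4P[/and3P[uv uw ux] /andP[vw vx'] wx _].
  have: size [:: u; w; x] <= 2; last by [].
  apply: (@degree_le2 v); rewrite /= ?inE ?negb_or ?uw ?ux ?wx //.
    by rewrite eq_sym uv vw vx'.
  by rewrite adj_vu adj_vw vx.
apply/fintype.subsetP => y; rewrite inE.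
(* The path is nonempty, so [K] is the component of its head, and closedness puts everything
   reachable from the head on the path. *)
case: s sz {us sorts max_s} sK closed_s => [/= sz0|x s _ /andP[/= xK _] cl].
  by rewrite -sz0 in m_gt0.
move: xK; rewrite mem_component // => /eqP ->; rewrite inE => xy.
have := closed_connect cl xy; rewrite /= => <-.
exact: mem_head.
Qed.

Lemma size_edges_in_component (K : {set V}) : K \in components E ->
  is_path E K + size (edges_in E K) = #|K|.
Proof.
move=> KE; have [s [us sorts sK]] := hamiltonian_component KE.
have cardK : #|K| = size s by rewrite -sK cardsE (card_uniqP us).
have K_gt0 : 0 < #|K|.
  by case/imsetP: KE => z _ ->; apply/card_gt0P; exists z; rewrite inE.
have sub : {subset path_edges s <= edges_in E K}.
  move=> e es; rewrite mem_filter (path_edges_sub sorts es) andbT.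
  by apply/fintype.subsetP => x xe; rewrite -sK inE (path_edges_subset es).
have ups := path_edges_uniq us.
have le1 := uniq_leq_size ups sub; rewrite size_path_edges -cardK in le1.
have le2 := size_edges_in_le K.
case: (boolP (is_path E K)) => [/existsP[t /and3P[_ _ /perm_size ->]]|npath].
  by rewrite size_path_edges size_tuple; lia.
suff: size (edges_in E K) != #|K|.-1.
  by move: le1 le2 K_gt0; move: (size _) (#|K|) => a b; lia.
(* With only [#|K|.-1] edges, the distinct edges of the Hamiltonian path [s] exhaust the edge list,
   multiplicities included, so [s] itself witnesses [is_path]. *)
apply: contra npath => /eqP szE; apply/existsP.
have sz_s : size s == #|K| by rewrite cardK.
exists (Tuple sz_s); rewrite /= us sK eqxx /=.
have le_sz : size (edges_in E K) <= size (path_edges s).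
  by rewrite size_path_edges -cardK szE.
have [_ eq_mem] := uniq_min_size ups sub le_sz.
rewrite perm_sym uniq_perm //.
by rewrite (leq_size_uniq ups sub le_sz).
Qed.

Lemma npaths_add_size : npaths E + size E = #|V|.
Proof.
rewrite -sum_card_component -sum_size_edges_in /npaths -sum1_card.
rewrite [X in X + _](eq_bigl (fun K => (K \in components E) && is_path E K));
  last by move=> K; rewrite inE.
rewrite big_mkcondr -big_split /=.
by apply: eq_bigr => K KE; rewrite -size_edges_in_component //; case: is_path.
Qed.

End MaxDegreeTwo.

(** * The arcs of a composition form a matching *)

Section Arcs.
Local Open Scope nat_scope.

Lemma size_arcs n c : size (arcs n c) = sumn (map half c).
Proof.
rewrite /arcs size_allpairs_dep; congr sumn.
apply: (@eq_from_nth _ 0); first by rewrite !size_map size_iota.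
move=> i; rewrite size_map size_iota => lt_ic.
by rewrite !(nth_map 0) ?size_iota // nth_iota.
Qed.

Lemma arc_bound c i j : i < size c -> j < nth 0 c i ->
  sumn (take i c) + j < sumn c.
Proof.
move=> ic jc; rewrite -[in X in _ < X](cat_take_drop i c) sumn_cat.
by rewrite (drop_nth 0) //= ltn_add2l ltn_addr.
Qed.

Lemma card_arc n c e : sumn c = n -> e \in arcs n c -> #|e| = 2.
Proof.
move=> sum_c /allpairsPdep[i [j [+ + ->]]]; rewrite !mem_iota add0n /=.
move=> ic j_range; set ci := nth 0 c i.
have lt1 : vpos c i j < n.
  have := @arc_bound c i j.-1 ic; rewrite /vpos -/ci in j_range *; lia.
have lt2 : vpos c i (ci.+1 - j) < n.
  have := @arc_bound c i (ci - j) ic; rewrite /vpos -/ci in j_range *; lia.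
have -> : [set x : 'I_n | (val x == vpos c i j)
    || (val x == vpos c i (ci.+1 - j))]%SET =
    [set Ordinal lt1; Ordinal lt2]%SET.
  by apply/setP => x; rewrite !inE -!val_eqE.
rewrite cards2 -val_eqE /= /vpos; rewrite -/ci in j_range.
by case: eqP => //; lia.
Qed.

Lemma arcs_matching n c (v : 'I_n) :
  count (fun e : {set 'I_n} => v \in e) (arcs n c) <= 1.
Proof.
pose pairs := [seq (i, j) | i <- iota 0 (size c), j <- iota 1 (nth 0 c i)./2].
pose f (p : nat * nat) := [set x : 'I_n | (val x == vpos c p.1 p.2)
   || (val x == vpos c p.1 ((nth 0 c p.1).+1 - p.2))]%SET.
have -> : arcs n c = map f pairs by rewrite /pairs map_allpairs.
have upairs : uniq pairs.
  apply: allpairs_uniq_dep => [|i _|]; rewrite ?iota_uniq //.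
  by case=> i1 j1 [i2 j2] _ _ /= [-> ->].
rewrite count_map.
(* The position [v] determines its block [i0] and its offset [r0] there. As [j] is at most half the
   block size, an arc at [v] has [j] equal to the smaller 1-based distance of [v] to the two ends of
   the block. *)
pose i0 := reshape_index c v; pose r0 := reshape_offset c v.
pose p0 := (i0, minn r0.+1 (nth 0 c i0 - r0)).
have uniq_p p : p \in pairs -> v \in f p -> p = p0.
  case/allpairsPdep=> i [j [+ + ->]]; rewrite !mem_iota add0n /= inE /=.
  move=> ic j_range v_pos.
  have [r [lt_r v_r j_r]] : exists r, [/\ r < nth 0 c i,
      v = sumn (take i c) + r :> nat & j = minn r.+1 (nth 0 c i - r)].
    case/orP: v_pos => /eqP ->; [exists j.-1|exists (nth 0 c i - j)];
      rewrite /vpos; split; lia.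
  have v_flat : v = flatten_index c i r :> nat by [].
  have i0E : i0 = i by rewrite /i0 v_flat flatten_indexKl.
  have r0E : r0 = r by rewrite /r0 v_flat flatten_indexKr.
  by rewrite /p0 i0E r0E j_r.
apply: (@leq_trans (count_mem p0 pairs)); last first.
  by rewrite (count_uniq_mem _ upairs) leq_b1.
rewrite -!size_filter; apply: uniq_leq_size; first exact: filter_uniq.
move=> p; rewrite !mem_filter => /andP[/= vp pp].
by rewrite pp (uniq_p p pp vp) /= eqxx.
Qed.

End Arcs.

(** * Parity of the index in terms of the number of odd parts *)

Lemma sumn_half_odd (s : seq nat) :
  sumn s = (count odd s + (sumn (map half s)).*2)%N.
Proof. by elim: s => //= x s ->; rewrite -[in LHS](odd_double_half x); lia. Qed.

(** Let h be the sum of the halves of the parts, rounded down, and n the sum of the parts. Vertices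
    minus edges is n - h - floor(n/2) = ceil(n/2) - h, and n = [count odd s] + 2h. *)
Lemma npaths_meander (s : seq nat) :
  npaths (meander (sumn s) s [:: sumn s]) = uphalf (count odd s).
Proof.
set E := meander _ _ _.
have cardE e : e \in E -> #|e| = 2%N.
  rewrite mem_cat => /orP[]; apply: card_arc => //=; exact: addn0.
have degE v : (count (fun e : {set 'I_(sumn s)} => v \in e) E <= 2)%N.
  by rewrite count_cat (leq_add (arcs_matching _ _) (arcs_matching _ _)).
have := npaths_add_size cardE degE.
rewrite card_ord size_cat !size_arcs /=.
have := sumn_half_odd s; lia.
Qed.

(** Cycles contribute an even number, so only the paths, less one, matter. The conventional value -1
    for the empty partition fits the same rule. *)
Lemma ind_even (lam : intpart) : (2 %| ind lam)%Z = odd (uphalf (op lam)).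
Proof.
rewrite /ind; case: nilP => [lam0|_]; first by rewrite /op lam0.
rewrite /ind_wrt npaths_meander -/(op lam); lia.
Qed.

(** * Counting functions as sums over a single enumeration of S_n, and evaluation at t = i *)

Lemma card_graded (S : set intpart) n (P : pred intpart) :
  #|` fset_set [set lam | graded S n lam /\ P lam]%classic |
  = count P (fset_set (graded S n)).
Proof.
have fin : finite_set [set lam | graded S n lam /\ P lam]%classic.
  by apply: sub_finite_set (finite_graded S n) => lam [].
rewrite -size_filter; apply/perm_size/uniq_perm;
  rewrite ?filter_uniq ?fset_uniq //.
move=> lam; rewrite mem_filter !in_fset_set //; last exact: finite_graded.
apply/idP/andP => [/set_mem[Slam Plam]|[Plam /set_mem Slam]].
  by split=> //; apply/mem_set.
exact/mem_set.
Qed.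

Lemma odd_op (lam : intpart) : odd (op lam) = odd (sumn lam).
Proof. by rewrite /op (sumn_half_odd lam) oddD odd_double addbF. Qed.

Lemma op_le_sumn (lam : intpart) : (op lam <= sumn lam)%N.
Proof. by rewrite /op [X in (_ <= X)%N]sumn_half_odd leq_addr. Qed.

(** Write k = 2a + d and n = 2b + d with d the common parity. Since i(-i) = 1, the left side is
    (-1)^(a+b); rounding up on the right adds d to both a and b, which leaves the sign unchanged. *)
Lemma expr_imaginary (C : numClosedFieldType) k n : odd k = odd n ->
  'i ^+ k * (- 'i) ^+ n = (-1) ^+ uphalf n * (-1) ^+ uphalf k :> C.
Proof.
move=> kn.
rewrite -{1}(odd_double_half k) -{1}(odd_double_half n) !uphalf_half kn.
rewrite !(exprD _ (odd n)) -!mul2n !exprM sqrrN sqrCi.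
case: (odd n); rewrite ?expr0 ?expr1 ?mul1r; last by rewrite mulrC.
by rewrite mulrACA mulrN -expr2 sqrCi; ring.
Qed.

(** After exchanging the sums over exponents and partitions, each [lam] contributes only at the
    exponent [op lam], which is at most n. *)
Lemma horner_F (R : comNzRingType) (S : set intpart) n (a : R) :
  (F_ R S n).[a] = \sum_(lam <- fset_set (graded S n)) a ^+ op lam.
Proof.
have szF : (size (F_ R S n) <= n.+1)%N.
  by apply/leq_sizeP => k nk; rewrite coef_F f_gt.
rewrite (horner_coef_wide _ szF).
have fE k : f_ S k n = (\sum_(lam <- fset_set (graded S n)) (op lam == k))%N.
  have -> : f_ S k n = count (fun lam => op lam == k) (fset_set (graded S n)).
    rewrite -card_graded /f_; congr (#|` fset_set _|).
    by apply/seteqP; split=> lam [Slam /eqP].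
  by rewrite -sum1_count big_mkcond; apply: eq_bigr => lam _; case: eqP.
under eq_bigr do rewrite coef_F fE natr_sum mulr_suml.
rewrite exchange_big /= !big_seq; apply: eq_bigr => lam.
rewrite in_fset_set; last exact: finite_graded.
move=> /set_mem[_ lamn].
have lt_op : (op lam < n.+1)%N by rewrite ltnS -lamn op_le_sumn.
rewrite (bigD1 (Ordinal lt_op)) //= eqxx mul1r big1 ?addr0 // => k.
by rewrite -val_eqE eq_sym /= => /negPf ->; rewrite mul0r.
Qed.

Theorem theorem2 (C : numClosedFieldType) (S : set intpart) :
  subst_tq (F_ C S) 'i (- 'i) =
  (fun n : nat => (-1) ^+ uphalf n * ((o_ S n)%:R - (e_ S n)%:R)).
Proof.
apply/funext => n; rewrite /subst_tq horner_F /o_ /e_ !card_graded.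
rewrite -!sum1_count !natr_sum [X in X - _]big_mkcond [X in _ - X]big_mkcond.
rewrite -sumrB /=.
rewrite mulr_suml mulr_sumr !big_seq; apply: eq_bigr => lam.
rewrite in_fset_set; last exact: finite_graded.
move=> /set_mem[_ lamn]; rewrite expr_imaginary; last by rewrite odd_op lamn.
(* Termwise comparison: an even index means an odd [uphalf (op lam)], with sign -1 matching the [e_]
   term; an odd index gives +1, matching [o_]. *)
rewrite ind_even -(signr_odd _ (uphalf (op lam))); case: odd => /=.
  by rewrite sub0r expr1.
by rewrite subr0 expr0.
Qed.
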